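(* Let $n,m\ge1$ be integers. Then $$\sum_{\lambda\subset(n^m)}f_\lambda(n)=m^n,$$ where the sum is over partitions $\lambda$ whose Young diagram is contained in the rectangle $(n^m)$ with $m$ rows of length $n$. Furthermore, there is a bijection between the set $W_{n,m}$ of words of length $n$ in the alphabet $[m]=\{1,\ldots,m\}$ and the set $\bigcup_{\lambda\subset(n^m)}\mathrm{ST}(\lambda,n)$ of strict tableaux with filling $[n]$ whose shape $\lambda$ is contained in $(n^m)$.
   Context: A plane partition $\pi=(\pi_{ij})_{i,j\ge1}$ is a two-dimensional array of nonnegative integers with finitely many nonzero entries such that $\pi_{ij}\ge\pi_{i+1\,j}$ and $\pi_{ij}\ge\pi_{i\,j+1}$ for all $i,j$ ($i$ is the row index, $j$ the column index). Zero entries are ignored; the shape of $\pi$ is the partition whose Young diagram is $\{(i,j):\pi_{ij}>0\}$. A plane partition $\pi$ is a strict tableau with filling $[n]=\{1,\ldots,n\}$ if its (nonzero) entries belong to $[n]$ and each $i\in[n]$ appears in exactly one column of $\pi$ (possibly several times in that column). $\mathrm{ST}(\lambda,n)$ is the set of strict tableaux of shape $\lambda$ with filling $[n]$, and $f_\lambda(n)=|\mathrm{ST}(\lambda,n)|$. *)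

(* Defs.v *)
From mathcomp Require Import all_boot.
From mathcomp Require Import mathcomp_extra boolp classical_sets functions cardinality fsbigop.
From mathcomp Require Import finmap.

Set Implicit Arguments.
Unset Strict Implicit.
Unset Printing Implicit Defensive.

Local Open Scope classical_set_scope.
Local Open Scope nat_scope.

(** Rows and columns are numbered from 0, so the entry [p i j] is the entry
    $\pi_{i+1,j+1}$ of the array. *)
Definition plane_partition (p : nat -> nat -> nat) : Prop :=
  [/\ finite_set [set c : nat * nat | p c.1 c.2 <> 0],
      forall i j, p i.+1 j <= p i j
    & forall i j, p i j.+1 <= p i j].

(** A partition is the list of its parts, all positive. *)
Definition is_partition (la : seq nat) : bool := sorted geq la && (0 \notin la).

Definition young_diagram (la : seq nat) : set (nat * nat) :=
  [set c | c.2 < nth 0 la c.1].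

Definition has_shape (p : nat -> nat -> nat) (la : seq nat) : Prop :=
  is_partition la /\ [set c : nat * nat | 0 < p c.1 c.2] = young_diagram la.

Definition in_column (p : nat -> nat -> nat) (k j : nat) : Prop :=
  exists i, p i j = k.

(** Entries equal to 0 are ignored: [p i j <= n] puts all other entries in
    {1, ..., n}. *)
Definition strict_tableau (n : nat) (p : nat -> nat -> nat) : Prop :=
  [/\ plane_partition p,
      forall i j, p i j <= n
    & forall k, 1 <= k <= n -> exists! j, in_column p k j].

Definition ST (la : seq nat) (n : nat) : set (nat -> nat -> nat) :=
  [set p | strict_tableau n p /\ has_shape p la].

(** [fset_set] is the empty set on infinite sets; see [finite_ST]. *)
Definition f_ (la : seq nat) (n : nat) : nat := #|` fset_set (ST la n)|%fset.

(** Partitions whose Young diagram lies in the rectangle with [m] rows of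
    length [n]. *)
Definition partitions_in_rect (n m : nat) : set (seq nat) :=
  [set la | is_partition la /\ young_diagram la `<=` young_diagram (nseq m n)].

Definition words (n m : nat) : set (n.-tuple nat) :=
  [set w | forall i, 1 <= tnth w i <= m].
Arguments words : clear implicits.

Lemma finite_partitions_in_rect (n m : nat) : finite_set (partitions_in_rect n m).
Proof.
pose g (t : m.-tuple 'I_n.+1) : seq nat := [seq x <- map val t | x != 0].
apply: (@sub_finite_set _ _ (range g)); last exact/finite_image/finite_finset.
move=> la [/andP[_ n0] sub].
have pos i : i < size la -> 0 < nth 0 la i.
  by move=> il; rewrite lt0n; apply: contra n0 => /eqP <-; exact: mem_nth.
have sz : size la <= m.
  rewrite leqNgt; apply/negP => lt_m.
  by have := sub (m, 0) (pos _ lt_m); rewrite /young_diagram /= nth_nseq ltnn.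
have le i : nth 0 la i <= n.
  case E: (nth 0 la i) => [//|k].
  have := sub (i, k); rewrite /young_diagram /= E nth_nseq => /(_ (ltnSn k)).
  by case: ifP.
exists [tuple inord (nth 0 la i) | i < m] => //.
rewrite /g /= -map_comp.
rewrite (eq_map (g := fun i : 'I_m => nth 0 la i)); last first.
  by move=> i /=; rewrite inordK// ltnS.
rewrite (map_comp (nth 0 la) val) val_enum_ord.
rewrite -(subnKC sz) iotaD map_cat filter_cat add0n.
rewrite -/(mkseq (nth 0 la) (size la)) mkseq_nth.
rewrite [X in _ ++ X](_ : _ = [::]) ?cats0.
  by apply/all_filterP/allP => x xl; apply: contra n0 => /eqP <-.
apply/eqP; rewrite -[_ == _]negbK -has_filter -all_predC; apply/allP => x.
move=> /mapP[i]; rewrite mem_iota => /andP[il _] ->.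
by rewrite /= nth_default.
Qed.

Lemma finite_ST (la : seq nat) (n : nat) : finite_set (ST la n).
Proof.
pose M := (sumn la).+1.
pose g (t : {ffun 'I_(size la) * 'I_M -> 'I_n.+1}) (i j : nat) : nat :=
  if insub i is Some i' then if insub j is Some j' then val (t (i', j')) else 0
  else 0.
apply: (@sub_finite_set _ _ (range g)); last exact/finite_image/finite_finset.
move=> p [[_ le _] [_ sh]].
have p0 i j : (nth 0 la i <= j) -> p i j = 0.
  move=> h; apply/eqP; rewrite -leqn0 leqNgt; apply/negP => hp.
  have : young_diagram la (i, j) by rewrite -sh.
  by rewrite /young_diagram /= ltnNge h.
exists [ffun c : 'I_(size la) * 'I_M => inord (p c.1 c.2)] => //.
apply/funext => i; apply/funext => j; rewrite /g.
case: insubP => [i' _ <-|]; last first.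
  by rewrite -leqNgt => h; rewrite p0// nth_default.
case: insubP => [j' _ <-|]; first by rewrite ffunE /= inordK// ltnS.
rewrite -leqNgt => h; rewrite p0// (leq_trans _ (ltnW h))//.
elim: (la) (val i') => [|x s IH] [|k] //=; first exact: leq_addr.
exact: leq_trans (IH k) (leq_addl _ _).
Qed.

(* Main.v *)
(** The level sets {pi >= n}, {pi >= n-1}, ..., {pi >= 1} of a strict tableau
    form a growing chain of Young diagrams in which each step adds a nonempty
    vertical strip inside a single column.  The lowest row r of the strip
    determines the step: its column is the first free cell of row r, and the
    strip fills that column down to row r.  Every r in [m] is allowed at every
    step, so the tableaux with at most m rows correspond to the words in [m]. *)
Require Import Defs.
From mathcomp Require Import all_boot.
From mathcomp Require Import mathcomp_extra boolp classical_sets functions cardinality fsbigop.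
From mathcomp Require Import finmap.

Set Implicit Arguments.
Unset Strict Implicit.

Local Open Scope classical_set_scope.
Local Open Scope nat_scope.

(** * Rows of strict tableaux and their ends *)

Lemma plane_partition_le p i i' j j' :
  plane_partition p -> i <= i' -> j <= j' -> p i' j' <= p i j.
Proof.
move=> [_ pr pc] /subnKC <- /subnKC <-.
elim: (i' - i) => [|k IH]; last by rewrite addnS (leq_trans (pr _ _)).
rewrite addn0; elim: (j' - j) => [|k IH]; first by rewrite addn0.
by rewrite addnS (leq_trans (pc _ _)).
Qed.

Lemma strict_tableau_column {n p i i' j j'} :
  strict_tableau n p -> 0 < p i j -> p i j = p i' j' -> j = j'.
Proof.
move=> [_ le ex] p0 e; have [|k [_ u]] := ex (p i j); first by rewrite p0 le.
by have <- : _ = j := u j _; [apply: u; exists i' | exists i].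
Qed.

Lemma strict_tableau_row_lt n p i j :
  strict_tableau n p -> 0 < p i j.+1 -> p i j.+1 < p i j.
Proof.
move=> st p0; have [[_ _ pc] _ _] := st; rewrite ltn_neqAle pc andbT.
by apply/eqP => /(strict_tableau_column st p0)/esym/n_Sn.
Qed.

(** A row strictly decreases from at most [n], so moving [j] cells to the right costs at least [j].
    Hence the width [n] of the rectangle is automatic and only the number of rows has to be
    bounded. *)
Lemma strict_tableau_row_size n p i : strict_tableau n p -> p i n = 0.
Proof.
move=> st; have H j : 0 < p i j -> p i j + j <= n.
  elim: j => [|j IH] p0; first by rewrite addn0; case: st => _ ->.
  have lt := strict_tableau_row_lt st p0.
  rewrite addnS -addSn; apply: leq_trans (IH (leq_trans _ lt)) => //.
  by rewrite leq_add2r.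
apply/eqP; rewrite -leqn0 leqNgt; apply/negP => p0.
by have := H n p0; rewrite -[leqRHS]add0n leq_add2r leqNgt p0.
Qed.

(** For a plane partition this says that row [r] has length [j]. As a relation it makes sense for
    every function [p], even one without zeros. *)
Definition row_end (p : nat -> nat -> nat) (r j : nat) : bool :=
  (p r j == 0) && ((j == 0) || (0 < p r j.-1)).

Lemma row_end_gt0 p r j k :
  plane_partition p -> row_end p r j -> (0 < p r k) = (k < j).
Proof.
move=> pp /andP[/eqP p0 pj]; apply/idP/idP => [pk|kj].
  rewrite ltnNge; apply/negP => jk.
  by have := plane_partition_le pp (leqnn r) jk; rewrite p0 leqNgt pk.
case: j kj pj {p0} => // j; rewrite ltnS /= => kj pj.
exact: leq_trans pj (plane_partition_le pp (leqnn r) kj).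
Qed.

Lemma row_end_inj p r j k :
  plane_partition p -> row_end p r j -> row_end p r k -> j = k.
Proof.
move=> pp ej ek; case: (ltngtP j k) => //.
  by rewrite -(row_end_gt0 _ pp ek); case/andP: ej => /eqP ->.
by rewrite -(row_end_gt0 _ pp ej); case/andP: ek => /eqP ->.
Qed.

Lemma row_end_ex n p r :
  strict_tableau n p -> exists2 j, j <= n & row_end p r j.
Proof.
move=> st; have ex : exists j, p r j == 0.
  by exists n; rewrite (strict_tableau_row_size _ st).
case: (ex_minnP ex) => j pj jmin; exists j.
  by apply: jmin; rewrite (strict_tableau_row_size _ st).
rewrite /row_end pj; case: j {pj} jmin => //= j jmin.
by rewrite lt0n; apply/negP => /jmin; rewrite ltnn.
Qed.

(** * Insertion of a vertical strip and its inverse *)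

(** Letters are 1-based as in the paper while rows are 0-based: the letter [r]
    designates the row [r.-1]. *)
Definition ins (p : nat -> nat -> nat) (r i j : nat) : nat :=
  if 0 < p i j then (p i j).+1 else ((i < r) && row_end p r.-1 j : bool).

(** New cells hold 1 and old entries move up by one, so a decrement restores [p] whatever [r] is. *)
Lemma ins_pred p r i j : (ins p r i j).-1 = p i j.
Proof. by rewrite /ins; case: (p i j) => //=; case: (_ && _). Qed.

Lemma ins_gt1 p r i j k : 0 < k -> (ins p r i j == k.+1) = (p i j == k).
Proof.
move=> k0; rewrite /ins; case: (p i j) => [|a] //=.
by case: (_ && _); case: k k0.
Qed.

Lemma ins_eq1 p r i j :
  (ins p r i j == 1) = [&& i < r, row_end p r.-1 j & p i j == 0].
Proof.
by rewrite /ins; case: (p i j) => [|a] //=;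
  rewrite ?andbT ?andbF //; case: (i < r) => //=; case: row_end.
Qed.

(** This is the union of [ST la n] over the rectangle, in a form that avoids the shape; see
    [bigcup_ST]. *)
Definition bounded_tableau (n m : nat) (p : nat -> nat -> nat) : Prop :=
  strict_tableau n p /\ forall i j, 0 < p i j -> i < m.

(** The new entries 1 occupy the free cells of column [j0] down to row [r.-1]. The rows above are at
    least as long as row [r.-1], so no gap appears to the left of the strip; the cell at row [r.-1]
    is itself free, so 1 does occur. *)
Lemma ins_bounded n m p r : 1 <= r <= m ->
  bounded_tableau n m p -> bounded_tableau n.+1 m (ins p r).
Proof.
move=> /andP[r0 rm] [st bd]; have [pp le ex] := st; have [fin pr pc] := pp.
have [j0 _ ej0] := row_end_ex r.-1 st; split; last first.
  move=> i j; rewrite /ins; case: ifP => [/bd//|_].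
  by case: (ltnP i r) => //= ir _; exact: leq_trans ir rm.
split.
- split.
  + pose C := [set (i, j0) | i in [set i | i < r]].
    apply: (@sub_finite_set _ _ ([set c | p c.1 c.2 <> 0] `|` C)).
      move=> [i j] /=; rewrite /ins; case: (ltnP 0 (p i j)) => [p0 _|_].
        by left; apply/eqP; rewrite -lt0n.
      case: (ltnP i r) => //= ir; case e: row_end => // _; right; exists i => //.
      by rewrite (row_end_inj pp e ej0).
    by rewrite finite_setU; split=> //; apply: finite_image; exact: finite_II.
  + move=> i j; rewrite /ins; case: (ltnP 0 (p i.+1 j)) => [p0|_].
      by rewrite (leq_trans p0 (pr _ _)) ltnS.
    case: (ltnP 0 (p i j)) => _; first by case: (_ && _).
    case: row_end; rewrite ?andbT ?andbF //.
    by case: (ltnP i.+1 r) => // /ltnW ->.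
  + move=> i j; rewrite /ins; case: (ltnP 0 (p i j.+1)) => [p0|_].
      by rewrite (leq_trans p0 (pc _ _)) ltnS.
    case: (ltnP 0 (p i j)) => pij; first by case: (_ && _).
    (* A new cell just right of a free one is impossible: row [r.-1] reaches column [j], hence so
       does row [i], which is not below it. *)
    case: (ltnP i r) => //= ir; case e: (row_end _ _ j.+1) => //.
    have ir' : i <= r.-1 by rewrite -ltnS prednK.
    have := plane_partition_le pp ir' (leqnn j).
    by case/andP: e => _ /= p0 /(leq_trans p0); rewrite ltnNge pij.
- by move=> i j; rewrite /ins; case: ifP => _; [rewrite ltnS|case: (_ && _)].
- case=> [//|[|k]] /andP[_ kn].
    exists j0; split=> [|j [i /eqP]].
      exists r.-1; apply/eqP; rewrite ins_eq1 ej0 prednK// leqnn /=.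
      by case/andP: ej0.
    by rewrite ins_eq1 => /and3P[_ e _]; exact: row_end_inj pp ej0 e.
  have [|j [[i pij] u]] := ex k.+1; first by rewrite -ltnS.
  exists j; split=> [|j' [i' /eqP]].
    by exists i; apply/eqP; rewrite ins_gt1// pij.
  by rewrite ins_gt1// => /eqP e; apply: u; exists i'.
Qed.

(** A decrement recovers the tableau, and the lowest row containing 1 recovers the letter. *)
Lemma ins_inj n p p' r r' : strict_tableau n p -> 0 < r -> 0 < r' ->
  ins p r = ins p' r' -> p = p' /\ r = r'.
Proof.
move=> st r0 r0' e.
have ep : p = p'.
  apply/funext => i; apply/funext => j.
  by rewrite -(ins_pred p r) e ins_pred.
split=> //; move: e; rewrite -{p'}ep; have [pp _ _] := st.
wlog lt : r r' r0 r0' / r < r'.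
  move=> W e; case: (ltngtP r r') => // lt; first exact: W e.
  by apply/esym/W.
have [j _ ej] := row_end_ex r'.-1 st.
(* The end of row [r'.-1] receives a 1 from [r'], but not from the smaller [r], whose strip stops
   above that row. *)
move=> /(congr1 (fun q => q r'.-1 j == 1)); rewrite !ins_eq1 ej prednK//.
rewrite leqnn (leqNgt r') lt /=.
by case/andP: ej => ->.
Qed.

(** The 1s of [q] lie in a single column [j0]. Decrementing removes them, and the lowest row holding
    one gives the letter. *)
Lemma ins_surj n m q : bounded_tableau n.+1 m q ->
  exists p r, [/\ 1 <= r <= m, bounded_tableau n m p & ins p r = q].
Proof.
move=> [st bd]; have [qq le ex] := st; have [fin qr qc] := qq.
have [|j0 [[i0 qi0] u]] := ex 1; first by [].
pose P r := q r j0 == 1.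
have exP : exists r, P r by exists i0; apply/eqP.
have bdP r : P r -> r <= m by move=> /eqP e; apply/ltnW/(bd _ j0); rewrite e.
case: (ex_maxnP exP bdP) => r /eqP qr1 rmax.
have rm : r < m by apply: (bd _ j0); rewrite qr1.
have u1 i j : q i j = 1 -> j0 = j by move=> e; apply: u; exists i.
(* The row [r] is 0-based, so its letter is [r.+1]. *)
exists (fun i j => (q i j).-1), r.+1; split; first by rewrite rm.
- split; last by move=> i j h; apply: (bd _ j); case: (q i j) h.
  split; first split.
  + apply: sub_finite_set fin => -[i j] /=; by case: (q i j).
  + by move=> i j; rewrite -!subn1 leq_sub2r.
  + by move=> i j; rewrite -!subn1 leq_sub2r.
  + by move=> i j; have := le i j; case: (q i j).
  + case=> // k /andP[_ kn].
    have [|j [[i qij] uk]] := ex k.+2; first by rewrite /= ltnS.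
    exists j; split=> [|j' [i' e]]; first by exists i; rewrite qij.
    by apply: uk; exists i'; case: (q i' j') e => //= _ ->.
apply/funext => i; apply/funext => j; rewrite /ins /row_end /= ltnS.
case qij: (q i j) => [|[|a]] //=.
(* A free cell of [q] must receive no 1. Column [j0] is excluded since [q i j0 >= q r j0 = 1]. Left
   of it, [q r j] would be a 1 in a second column. Right of it, the cell before [j] in row [r] holds
   at most 1, so it is free after the decrement and the row does not end at [j]. *)
- case: (leqP i r) => //= ir; case: eqP => //= qrj.
  have jj0 : j != j0.
    apply/eqP => e; have := plane_partition_le qq ir (leqnn j0).
    by rewrite qr1 -e qij.
  case: (ltngtP j j0) jj0 => // jj0 _.
    have := plane_partition_le qq (leqnn r) (ltnW jj0); rewrite qr1 => q0.
    have /u1 e : q r j = 1 by case: (q r j) qrj q0 => // -[].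
    by rewrite e ltnn in jj0.
  case: j jj0 {qij qrj} => //= j; rewrite ltnS => jj0.
  have := plane_partition_le qq (leqnn r) jj0; rewrite qr1.
  by case: (q r j) => [|[]].
(* If [j0] is positive, the left neighbour of the 1 in row [r] is at least 1, and not 1 because 1
   stays in column [j0]. It survives the decrement, so row [r] then ends at [j0]. *)
- have e := u1 _ _ qij; subst j.
  rewrite qr1 /= rmax ?/P ?qij //=.
  case: j0 u u1 {P exP bdP rmax qij qi0} qr1 => //= j u u1 qr1.
  have := qc r j; rewrite qr1.
  case E: (q r j) => [|[|b]] // _.
  by have /eqP := u1 _ _ E; rewrite eq_sym -[_ == _]negbK neq_ltn ltnSn.
Qed.

(** * From words to tableaux *)

(** The head letter is inserted last. For positive letters, the [k]-th letter (counting from 1) thus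
    names the lowest row, also counted from 1, that contains the entry [k]. *)
Fixpoint tableau_of_word (w : seq nat) : nat -> nat -> nat :=
  if w is r :: w' then ins (tableau_of_word w') r else fun _ _ => 0.

Lemma tableau_of_word_bounded m w : all (fun r => 1 <= r <= m) w ->
  bounded_tableau (size w) m (tableau_of_word w).
Proof.
elim: w => [_|r w IH /= /andP[rm /IH]]; last exact: ins_bounded.
split=> //; split=> //; last by case=> // k; rewrite andbF.
by split=> //=; rewrite (_ : [set _ | _] = set0) //; apply/seteqP; split=> c.
Qed.

Lemma tableau_of_word_inj m w w' :
  all (fun r => 1 <= r <= m) w -> all (fun r => 1 <= r <= m) w' ->
  size w = size w' -> tableau_of_word w = tableau_of_word w' -> w = w'.
Proof.
elim: w w' => [|r w IH] [|r' w'] //= /andP[/andP[r0 _] aw].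
move=> /andP[/andP[r0' _] aw'] [sz] e.
have [st _] := tableau_of_word_bounded aw.
by have [/(IH _ aw aw' sz) -> ->] := ins_inj st r0 r0' e.
Qed.

Lemma tableau_of_word_surj n m p : bounded_tableau n m p ->
  exists w, [/\ size w = n, all (fun r => 1 <= r <= m) w
              & tableau_of_word w = p].
Proof.
elim: n p => [|n IH] p.
  move=> [[_ le _] _]; exists [::]; split=> //.
  apply/funext => i; apply/funext => j; apply/esym/eqP.
  by rewrite -leqn0.
move=> /ins_surj[q [r [rm /IH[w [sw aw wq]] <-]]].
by exists (r :: w); rewrite /= sw rm aw wq.
Qed.

(** * Shapes inside the rectangle *)

(** The diagram determines every row length, and positivity of the parts rules out trailing zeros.
    This makes the sets [ST la n] disjoint. *)
Lemma has_shape_inj p la mu : has_shape p la -> has_shape p mu -> la = mu.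
Proof.
move=> [pla sla] [pmu smu].
have nthE i : nth 0 la i = nth 0 mu i.
  case: (ltngtP (nth 0 la i) (nth 0 mu i)) => // lt.
    have : young_diagram mu (i, nth 0 la i) by [].
    by rewrite -smu sla /young_diagram /= ltnn.
  have : young_diagram la (i, nth 0 mu i) by [].
  by rewrite -sla smu /young_diagram /= ltnn.
have sz s t : is_partition s -> nth 0 s =1 nth 0 t -> size s <= size t.
  move=> /andP[_ s0] e; rewrite leqNgt; apply/negP => lt.
  by case/negP: s0; rewrite -(nth_default 0 (leqnn (size t))) -e mem_nth.
apply: (@eq_from_nth _ 0) => [|i _]; last exact: nthE.
by apply/eqP; rewrite eqn_leq !sz// => i; rewrite nthE.
Qed.

Lemma bounded_tableau_shape n m p : bounded_tableau n m p ->
  exists la, partitions_in_rect n m la /\ has_shape p la.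
Proof.
move=> [st bd]; have [pp _ _] := st.
have exl i : exists j, row_end p i j.
  by have [j _ ej] := row_end_ex i st; exists j.
pose l i := xchoose (exl i).
have lP i j : (0 < p i j) = (j < l i).
  by apply: row_end_gt0 => //; exact: (xchooseP (exl i)).
have lmono i i' : i <= i' -> l i' <= l i.
  move=> ii'; rewrite leqNgt -lP; apply/negP => lt.
  have := leq_trans lt (plane_partition_le pp ii' (leqnn _)).
  by rewrite lP ltnn.
have ln i : l i <= n by rewrite leqNgt -lP (strict_tableau_row_size _ st).
have exM : exists i, l i == 0.
  by exists m; rewrite -leqn0 leqNgt -lP; apply/negP => /bd; rewrite ltnn.
(* Cutting at the first empty row makes all parts positive; later rows are empty by [lmono]. *)
case: (ex_minnP exM) => M /eqP lM Mmin; pose la := mkseq l M.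
have nthE i : nth 0 la i = l i.
  have [iM|Mi] := ltnP i M; first by rewrite nth_mkseq.
  rewrite nth_default ?size_mkseq//; apply/esym/eqP.
  by rewrite -leqn0 -lM lmono.
have laP : is_partition la.
  apply/andP; split.
    by apply/(sortedP 0) => i _; rewrite !nthE; exact: lmono.
  apply/mapP => -[i]; rewrite mem_iota /= add0n => iM /esym/eqP/Mmin.
  by rewrite leqNgt iM.
have sh : [set c : nat * nat | 0 < p c.1 c.2] = young_diagram la.
  by apply/seteqP; split=> -[i j]; rewrite /young_diagram /= nthE lP.
exists la; split; last by [].
split=> // -[i j]; rewrite /young_diagram /= nthE nth_nseq => lt.
by rewrite (bd i j) ?lP// (leq_trans lt).
Qed.

Lemma bigcup_ST n m :
  \bigcup_(la in partitions_in_rect n m) ST la n = bounded_tableau n m.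
Proof.
apply/seteqP; split=> [p [la [_ sub]] [st [_ sh]]|p bt].
  split=> // i j p0; have /sub : young_diagram la (i, j) by rewrite -sh.
  by rewrite /young_diagram /= nth_nseq; case: ifP.
have [la [laR sh]] := bounded_tableau_shape bt.
by exists la => //; case: bt.
Qed.

Lemma words_all n m (w : n.-tuple nat) :
  words n m w <-> all (fun r => 1 <= r <= m) w.
Proof. by split=> [h|/all_tnthP//]; exact/all_tnthP. Qed.

Lemma tableau_of_word_bij n m :
  set_bij (words n m) (bounded_tableau n m)
    (fun w : n.-tuple nat => tableau_of_word w).
Proof.
split=> [w /words_all aw|w w' /set_mem/words_all aw /set_mem/words_all aw' e|p].
- by have := tableau_of_word_bounded aw; rewrite size_tuple.
- by apply/val_inj/(tableau_of_word_inj aw aw' _ e); rewrite !size_tuple.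
move=> /tableau_of_word_surj[w [/eqP sw aw wp]].
by exists (Tuple sw); first exact/words_all.
Qed.

(** * Counting *)

Lemma card_words n m : (words n m #= `I_(m ^ n))%card.
Proof.
pose f (t : n.-tuple 'I_m) : n.-tuple nat := [tuple (tnth t i).+1 | i < n].
have -> : words n m = [set f t | t in setT].
  apply/seteqP; split=> [w wm|_ [t _ <-] i]; last by rewrite tnth_mktuple /=.
  have lt i : (tnth w i).-1 < m by have /andP[] := wm i; case: (tnth w i).
  exists [tuple Ordinal (lt i) | i < n] => //.
  apply: eq_from_tnth => i; rewrite !tnth_mktuple /= prednK//.
  by case/andP: (wm i).
rewrite (card_eql (inj_card_eq _)) => [|t t' _ _ e]; last first.
  apply: eq_from_tnth => i; have := congr1 (fun w => tnth w i) e.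
  by rewrite /f !tnth_mktuple => -[] /val_inj.
have -> : [set: n.-tuple 'I_m] = [set` [fset t in {: n.-tuple 'I_m}]%fset].
  by apply/seteqP; split=> t //= _; rewrite inE.
by apply/card_eq_fsetP; rewrite card_finset card_tuple card_ord.
Qed.

(** Over finite sets both sides count points, and each point of the union lies in exactly one member
    of the family. *)
Lemma sum_card_trivIset (I T : choiceType) (D : set I) (F : I -> set T) :
  finite_set D -> (forall i, finite_set (F i)) -> trivIset D F ->
  \big[addn/0]_(i \in D) #|` fset_set (F i)|%fset
    = #|` fset_set (\bigcup_(i in D) F i)|%fset.
Proof.
move=> finD finF tF.
have -> : fset_set (\bigcup_(i in D) F i) =
    (\bigcup_(i <- fset_set D) fset_set (F i))%fset.
  apply/fsetP => x; rewrite in_fset_set; last exact: bigcup_finite.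
  apply/idP/bigfcupP => [/set_mem[i Di Fx]|[i /andP[]]].
    by exists i; rewrite ?in_fset_set// ?andbT; exact/mem_set.
  rewrite !in_fset_set// => /set_mem Di _ /set_mem Fx.
  by apply/mem_set; exists i.
rewrite card_fset_sum1 partition_disjoint_bigfcup; last first.
  move=> i j; rewrite !in_fset_set// => /set_mem Di /set_mem Dj.
  (* [trivIset] equates the indices of two members that meet, so the contrapositive is proved. *)
  apply: contraNT => /fdisjointP dis.
  apply/eqP/tF => //; apply/set0P/negP => /eqP FF0; apply: dis => x.
  rewrite !in_fset_set// => /set_mem Fi; apply/negP => /set_mem Fj.
  by rewrite -[False]/(set0 x) -FF0.
by rewrite fsbig_finite//; apply: eq_bigr => i _; rewrite card_fset_sum1.
Qed.

Unset Implicit Arguments.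
Set Strict Implicit.

Theorem theorem7p1 (n m : nat) (hn : 1 <= n) (hm : 1 <= m) :
  \big[addn/0]_(la \in partitions_in_rect n m) f_ la n = m ^ n
  /\
  exists phi : n.-tuple nat -> (nat -> nat -> nat),
    set_bij (words n m) (\bigcup_(la in partitions_in_rect n m) ST la n) phi.
Proof.
have bij := tableau_of_word_bij n m.
split; last by rewrite bigcup_ST; eexists; exact: bij.
(* The sum becomes the cardinal of the union, which the bijection with words computes. *)
rewrite sum_card_trivIset.
- rewrite bigcup_ST; apply: card_fset_set.
  case: bij => [fun_ inj_ surj_].
  have <- : [set tableau_of_word (val w) | w in words n m] = bounded_tableau n m.
    by apply/seteqP; split=> [_ [w ww <-]|]; [exact: fun_|exact: surj_].
  by rewrite (card_eql (inj_card_eq inj_)); exact: card_words.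
- exact: finite_partitions_in_rect.
- by move=> la; exact: finite_ST.
- move=> la mu _ _ [p [[_ sla] [_ smu]]]; exact: has_shape_inj sla smu.
Qed.
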